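(* If a graph $G$ of order $n$ with $m$ edges and independence number $2$ satisfies $$\sum_{i\in[n]}\left|d_i-\frac{2m}{n}\right|=o(n^2),$$ then $$t_4(G)\geq\frac{1}{200}n^4+o(n^4).$$ Explicitly: for every $\varepsilon>0$ there exist $\delta>0$ and $n_0$ such that every graph $G$ of order $n\geq n_0$ with $m$ edges, with independence number $2$, and with $\sum_{i\in[n]}\left|d_i-\frac{2m}{n}\right|\leq\delta n^2$ satisfies $t_4(G)\geq\left(\frac{1}{200}-\varepsilon\right)n^4$.
   Context: All graphs are finite and simple, and a graph of order $n$ has vertex set $[n]=\{1,2,\dots,n\}$. $d_i$ denotes the degree of vertex $i$, and $t_4(G)$ denotes the number of $4$-cliques of $G$ (sets of $4$ pairwise adjacent vertices). The independence number is the maximum size of a set of pairwise nonadjacent vertices. *)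

(* Defs.v *)
From HB Require Import structures.
From mathcomp Require Import all_boot all_order all_algebra.
From mathcomp Require Export reals.

Set Implicit Arguments.
Unset Strict Implicit.
Unset Printing Implicit Defensive.

Record sgraph (T : finType) := SGraph {
  adj :> rel T;
  adj_sym : symmetric adj;
  adj_irr : irreflexive adj
}.

Section Graph.
Variables (T : finType) (G : sgraph T).

Definition degree (x : T) : nat := #|[set y | G x y]|.

Definition edges : {set {set T}} :=
  [set [set p.1; p.2] | p : T * T & G p.1 p.2].

Definition clique (K : {set T}) : bool :=
  [forall x in K, forall y in K, (x != y) ==> G x y].

Definition independent (S : {set T}) : bool :=
  [forall x in S, forall y in S, ~~ G x y].

Definition independence_number : nat :=
  \max_(S : {set T} | independent S) #|S|.

Definition num_cliques (k : nat) : nat :=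
  #|[set K : {set T} | clique K & #|K| == k]|.

End Graph.

(* Main.v *)
Require Import Defs.
From mathcomp Require Import all_boot all_order all_algebra reals.
From mathcomp Require Import ring lra.
Import Order.TTheory GRing.Theory Num.Theory.
Local Open Scope ring_scope.

(** Let H be the complement of G: it is triangle-free because G has
    independence number 2.  Let a be its adjacency function and h its degree
    function.  For an edge xy of H put r_z = 1 - a(x,z) - a(y,z), which is
    nonnegative by triangle-freeness; summing a(x,y) a(z,w) r_z r_w >= 0 bounds
    the number of 4-cycles of H from below by 2 P - S_1^2 / 2, where P counts
    walks of length 3 and S_k is the sum of the k-th powers of the degrees.
    Inserting this in the inclusion-exclusion formula for the number I of
    ordered 4-tuples without an edge of H, and using P <= S_3, gives
      I >= n^4 - 6 n^2 S_1 + 12 n S_2 + 3/2 S_1^2 - 10 S_3.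
    When all degrees are close to b n, the right-hand side is close to
    n^4 (1 - 6 b + 27/2 b^2 - 10 b^3)
      = n^4 (3/25 + 10 (b - 2/5)^2 (11/20 - b)),
    and b <= 1/2 by Mantel's theorem.  All but O(n^3) of the I tuples are
    orderings of 4-cliques of G. *)

(** * Sums over ordered quadruples and their symmetrization *)

Section Sum4.
Variables (T : finType) (R : realFieldType).
Implicit Types F : T -> T -> T -> T -> R.

Lemma sum_const (c : R) : \sum_(x : T) c = #|T|%:R * c.
Proof. by rewrite sumr_const mulr_natl. Qed.

Definition sum4 F : R := \sum_x \sum_y \sum_z \sum_w F x y z w.

Lemma sum4_const c : sum4 (fun _ _ _ _ => c) = #|T|%:R ^+ 4 * c.
Proof. by rewrite /sum4 !sum_const; ring. Qed.

Lemma ler_sum4 F1 F2 :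
  (forall x y z w, F1 x y z w <= F2 x y z w) -> sum4 F1 <= sum4 F2.
Proof. by move=> leF; do 4!apply: ler_sum => ? _. Qed.

Lemma sum4D F1 F2 :
  sum4 (fun x y z w => F1 x y z w + F2 x y z w) = sum4 F1 + sum4 F2.
Proof.
rewrite /sum4 -big_split; apply: eq_bigr => x _ /=.
rewrite -big_split; apply: eq_bigr => y _ /=.
by rewrite -big_split; apply: eq_bigr => z _ /=; rewrite -big_split.
Qed.

Lemma sum4Z c F : sum4 (fun x y z w => c * F x y z w) = c * sum4 F.
Proof.
rewrite /sum4 mulr_sumr; apply: eq_bigr => x _.
rewrite mulr_sumr; apply: eq_bigr => y _.
by rewrite mulr_sumr; apply: eq_bigr => z _; rewrite mulr_sumr.
Qed.

Lemma sum4_sum (I : finType) (P : pred I) (F : I -> T -> T -> T -> T -> R) :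
  sum4 (fun x y z w => \sum_(i | P i) F i x y z w) = \sum_(i | P i) sum4 (F i).
Proof.
rewrite /sum4 [RHS]exchange_big; apply: eq_bigr => x _ /=.
rewrite [RHS]exchange_big; apply: eq_bigr => y _ /=.
by rewrite [RHS]exchange_big; apply: eq_bigr => z _; exact: exchange_big.
Qed.

Lemma sum4_swap12 F : sum4 (fun x y z w => F y x z w) = sum4 F.
Proof. exact: exchange_big. Qed.

Lemma sum4_swap23 F : sum4 (fun x y z w => F x z y w) = sum4 F.
Proof. by apply: eq_bigr => x _; exact: exchange_big. Qed.

Lemma sum4_swap34 F : sum4 (fun x y z w => F x y w z) = sum4 F.
Proof. by do 2![apply: eq_bigr => ? _]; exact: exchange_big. Qed.

(** Coset representatives along S2 < S3 < S4: [sym3] chooses the entry in third place and [sym4] the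
    one in fourth place, so [sym24] sums [F] over all 24 permutations of its arguments. *)
Definition sym2 F x y z w := F x y z w + F y x z w.
Definition sym3 F x y z w := F x y z w + F x z y w + F y z x w.
Definition sym4 F x y z w :=
  F x y z w + F x y w z + F x z w y + F y z w x.
Definition sym24 F := sym4 (sym3 (sym2 F)).

Lemma sum4_sym24 F : sum4 (sym24 F) = 24 * sum4 F.
Proof.
have s2 G : sum4 (sym2 G) = 2 * sum4 G.
  by rewrite sum4D (sum4_swap12 G); ring.
have s3 G : sum4 (sym3 G) = 3 * sum4 G.
  rewrite !sum4D (sum4_swap12 (fun x y z w => G x z y w)) (sum4_swap23 G).
  by ring.
have s4 G : sum4 (sym4 G) = 4 * sum4 G.
  rewrite !sum4D (sum4_swap12 (fun x y z w => G x z w y)).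
  rewrite (sum4_swap23 (fun x y z w => G x y w z)) (sum4_swap34 G).
  by ring.
by rewrite s4 s3 s2; ring.
Qed.

End Sum4.
Arguments sum4 {T R} F.
Arguments sym24 {T R} F.

(** * Independent quadruples in a triangle-free graph *)

Section TriangleFree.
Variables (T : finType) (R : realFieldType) (H : rel T).
Hypothesis H_sym : symmetric H.
Hypothesis H_triangle : forall x y z, ~~ [&& H x y, H y z & H x z].

Local Notation a x y := ((H x y)%:R : R).
Local Notation h x := (\sum_y a x y).
Local Notation n := (#|T|%:R : R).

Definition indep4 x y z w : R :=
  (1 - a x y) * (1 - a x z) * (1 - a x w) *
  (1 - a y z) * (1 - a y w) * (1 - a z w).

Lemma indep4E x y z w : indep4 x y z w =
  [&& ~~ H x y, ~~ H x z, ~~ H x w, ~~ H y z, ~~ H y w & ~~ H z w]%:R.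
Proof.
rewrite /indep4; case: (H x y); case: (H x z); case: (H x w); case: (H y z);
  case: (H y w); case: (H z w); rewrite /= ?subrr ?subr0 ?mulr0 ?mul0r ?mulr1 //.
Qed.

(* Inclusion-exclusion combined with the 4-cycle bound; the inequality holds
   separately for each labelled triangle-free graph on four vertices. *)
Lemma indep4_sym24 x y z w :
  sym24 (fun x y z w => 1 + (-6 * a x y + (12 * (a x y * a x z)
     + (3 / 2 * (a x y * a z w) + (- 4 * (a x y * a x z * a x w)
     + - 6 * (a x y * a y z * a z w)))))) x y z w
  <= 24 * indep4 x y z w.
Proof.
rewrite /sym24 /sym4 /sym3 /sym2 /indep4.
rewrite !(H_sym y x, H_sym z x, H_sym w x, H_sym z y, H_sym w y, H_sym w z).
move: (H_triangle x y z) (H_triangle x y w) (H_triangle x z w)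
  (H_triangle y z w).
case: (H x y); case: (H x z); case: (H x w); case: (H y z); case: (H y w);
case: (H z w) => //= _ _ _ _; lra.
Qed.

Local Notation S1 := (\sum_x h x).
Local Notation S2 := (\sum_x h x ^+ 2).
Local Notation S3 := (\sum_x h x ^+ 3).

(** AM-GM on each edge: [h y * h z] is at most the mean of the two squares, and each square summed
    over ordered edges gives [S3]. *)
Lemma sum_adj_deg_le : \sum_y \sum_z a y z * (h y * h z) <= S3.
Proof.
have e1 : \sum_y \sum_z a y z * h y ^+ 2 = S3.
  by apply: eq_bigr => y _; rewrite -mulr_suml exprS.
have e2 : \sum_y \sum_z a y z * h z ^+ 2 = S3.
  rewrite exchange_big -e1; apply: eq_bigr => y _; apply: eq_bigr => z _.
  by rewrite H_sym.
suff : 2 * (\sum_y \sum_z a y z * (h y * h z)) <= S3 + S3 by lra.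
rewrite -{1}e1 -e2 -big_split mulr_sumr; apply: ler_sum => y _.
rewrite -big_split mulr_sumr; apply: ler_sum => z _ /=.
rewrite mulrCA -mulrDr; apply: ler_wpM2l; first exact: ler0n.
by have := sqr_ge0 (h y - h z); nra.
Qed.

Lemma sum4_indep4_ge :
  n ^+ 4 - 6 * n ^+ 2 * S1 + 12 * n * S2 + 3 / 2 * S1 ^+ 2 - 10 * S3
  <= sum4 indep4.
Proof.
have := ler_sum4 _ _ _ _ indep4_sym24.
rewrite sum4_sym24 sum4Z ler_pM2l // !(sum4D, sum4Z) sum4_const mulr1.
have -> : sum4 (fun x y _ _ => a x y) = n ^+ 2 * S1.
  rewrite /sum4 mulr_sumr; apply: eq_bigr => x _.
  by rewrite mulr_sumr; apply: eq_bigr => y _; rewrite !sum_const; ring.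
have -> : sum4 (fun x y z _ => a x y * a x z) = n * S2.
  rewrite /sum4 mulr_sumr; apply: eq_bigr => x _.
  rewrite expr2 mulr_suml mulr_sumr; apply: eq_bigr => y _.
  by rewrite 2!mulr_sumr; apply: eq_bigr => z _; rewrite sum_const.
have -> : sum4 (fun x y z w => a x y * a z w) = S1 ^+ 2.
  rewrite /sum4 expr2 mulr_suml; apply: eq_bigr => x _.
  rewrite mulr_suml; apply: eq_bigr => y _.
  by rewrite mulr_sumr; apply: eq_bigr => z _; rewrite mulr_sumr.
have -> : sum4 (fun x y z w => a x y * a x z * a x w) = S3.
  rewrite /sum4; apply: eq_bigr => x _.
  have -> (c : R) : c ^+ 3 = c * (c * c) by ring.
  rewrite mulr_suml; apply: eq_bigr => y _.
  rewrite mulrA mulr_sumr; apply: eq_bigr => z _.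
  by rewrite mulrAC mulr_sumr.
(* Walks of length 3 are grouped by their middle edge [y z]. *)
have -> : sum4 (fun x y z w => a x y * a y z * a z w)
    = \sum_y \sum_z a y z * (h y * h z).
  rewrite /sum4 exchange_big; apply: eq_bigr => y _.
  rewrite exchange_big; apply: eq_bigr => z _ /=.
  rewrite mulr_suml mulr_sumr; apply: eq_bigr => x _.
  rewrite 2!mulr_sumr; apply: eq_bigr => w _.
  by rewrite (H_sym x y); ring.
have := sum_adj_deg_le; lra.
Qed.

(** Mantel's argument: the ends of an edge have disjoint neighbourhoods, so their degrees add up to
    at most [n]; this is summed over ordered edges. *)
Lemma sum_deg_sqr_le : 2 * S2 <= n * S1.
Proof.
have e1 : \sum_x \sum_y a x y * h x = S2.
  by apply: eq_bigr => x _; rewrite -mulr_suml expr2.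
have e2 : \sum_x \sum_y a x y * h y = S2.
  rewrite exchange_big -e1; apply: eq_bigr => y _; apply: eq_bigr => z _.
  by rewrite H_sym.
rewrite mulr_natl mulr2n -{1}e1 -e2 -big_split mulr_sumr.
apply: ler_sum => x _; rewrite -big_split mulr_sumr; apply: ler_sum => y _ /=.
rewrite -mulrDr -big_split mulr_sumr -sum_const.
apply: ler_sum => z _ /=.
move: (H_triangle x y z).
by case: (H x y); case: (H y z); case: (H x z) => //= _; lra.
Qed.

(** The centre [c] is arbitrary, so it need not be identified with the mean degree. The constant 60
    is 10 (coefficient of [S3]) times 3 (difference of cubes) times 2 (change of centre). *)
Lemma sum4_indep4_lower (c : R) : 0 < n ->
  3 / 25 * n ^+ 4 - 60 * n ^+ 2 * (\sum_x `|h x - c|) <= sum4 indep4.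
Proof.
move=> n_gt0; apply: le_trans sum4_indep4_ge.
have [D S1E] : exists D, S1 = n * D.
  by exists (S1 / n); rewrite mulrC divfK // gt_eqF.
have h_ge0 x : 0 <= h x by apply: sumr_ge0 => y _; exact: ler0n.
have h_le x : h x <= n.
  rewrite -[n]mulr1 -sum_const; apply: ler_sum => y _.
  by rewrite lern1 leq_b1.
have D_ge0 : 0 <= D.
  by rewrite -(pmulr_rge0 _ n_gt0) -S1E; apply: sumr_ge0.
(* Convexity: the square lies above its tangent line at the mean [D]. *)
have S2_ge : n * D ^+ 2 <= S2.
  have -> : n * D ^+ 2 = \sum_x (2 * D * h x - D ^+ 2).
    by rewrite sumrB -mulr_sumr S1E sum_const; ring.
  by apply: ler_sum => x _; have := sqr_ge0 (h x - D); nra.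
have D_le : D <= n / 2.
  have := sum_deg_sqr_le; rewrite S1E => S2_le.
  have {S2_le} : n * (D * (n - 2 * D)) >= 0 by lra.
  by rewrite pmulr_rge0 // => D_max; rewrite leNgt; apply/negP; nra.
(* Replacing c by the mean degree D at most doubles the deviation. *)
have dev : \sum_x `|h x - D| <= 2 * \sum_x `|h x - c|.
  have cD : n * `|c - D| <= \sum_x `|h x - c|.
    rewrite -(gtr0_norm n_gt0) -normrM mulrBr -S1E -sum_const -sumrB.
    by apply: le_trans (ler_norm_sum _ _ _) _; apply: ler_sum => x _;
      rewrite distrC.
  rewrite mulr_natl mulr2n; apply: le_trans (lerD (lexx _) cD).
  rewrite -sum_const -big_split; apply: ler_sum => x _ /=.
  exact: ler_distD.
(* The cofactor of [t - D] in [t ^+ 3 - D ^+ 3] is at most [3 * n ^+ 2], since [t] and [D] lie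
   between 0 and [n]. *)
have S3_le : S3 <= n * D ^+ 3 + 3 * n ^+ 2 * \sum_x `|h x - D|.
  rewrite -sum_const mulr_sumr -big_split; apply: ler_sum => x _ /=.
  move: (h x) (h_ge0 x) (h_le x) => t t_ge0 t_le.
  have -> : t ^+ 3 = D ^+ 3 + (t ^+ 2 + t * D + D ^+ 2) * (t - D) by ring.
  rewrite lerD2l; apply: le_trans (ler_norm _) _.
  rewrite normrM ler_wpM2r // ger0_norm; nra.
have := ler_wpM2l (ltW n_gt0) S2_ge.
(* The factored polynomial in homogeneous form, with [D] for b n; Mantel's bound makes the last
   factor positive. *)
have : 0 <= n * ((D - 2 / 5 * n) ^+ 2 * (11 / 20 * n - D)).
  rewrite pmulr_rge0 // mulr_ge0 ?sqr_ge0 //; lra.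
have := ler_wpM2l (sqr_ge0 n) dev.
rewrite S1E; nra.
Qed.
End TriangleFree.

(** * From independent quadruples to 4-cliques *)

Section Counting.
Variables (T : finType) (R : realFieldType).

(** Truncated subtraction is harmless: when the first factor is nonzero, [s] lists [k] distinct
    elements of [K], so [k] is at most [#|K|]. *)
Lemma sum_distinct_cons (K : {set T}) (s : seq T) (k : nat) : size s = k ->
  \sum_x (all [in K] (x :: s) && uniq (x :: s))%:R
  = (all [in K] s && uniq s)%:R * (#|K| - k)%:R :> R.
Proof.
move=> <-; rewrite -natr_sum -natrM; congr _%:R.
have [/andP[sK s_uniq]|s_bad] := boolP (all _ s && uniq s).
  rewrite mul1n -(card_uniqP s_uniq) -[#|s|]cardsE -cardsDS; last first.
    by apply/subsetP => x; rewrite inE => /(allP sK).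
  rewrite -sum1_card [RHS]big_mkcond; apply: eq_bigr => x _ /=.
  by rewrite sK s_uniq !inE !andbT andbC; case: andP.
rewrite mul0n big1 // => x _ /=; move: s_bad.
by case: (all _ s); case: (uniq s); rewrite ?andbF.
Qed.

(** The list is reversed so that the innermost summation variable is its head. *)
Lemma sum4_distinct (K : {set T}) :
  sum4 (fun x y z w =>
    (all [in K] [:: w; z; y; x] && uniq [:: w; z; y; x])%:R)
  = (#|K| ^_ 4)%:R :> R.
Proof.
rewrite /sum4.
under eq_bigr => x _ do under eq_bigr => y _ do under eq_bigr => z _ do
  rewrite (sum_distinct_cons _ _ 3) //.
under eq_bigr => x _ do under eq_bigr => y _ do
  rewrite -mulr_suml (sum_distinct_cons _ _ 2) //.
under eq_bigr => x _ do rewrite -!mulr_suml (sum_distinct_cons _ _ 1) //.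
by rewrite -!mulr_suml (sum_distinct_cons _ _ 0) //= mul1r -!natrM !ffactnSr mul1n.
Qed.

(** Compared tuple by tuple: the indicators of independence in the complement and of distinctness
    add up to at most 1 unless both hold, and then the entries form a 4-clique. Each clique has 24
    orderings. *)
Lemma sum4_clique_le (G : sgraph T) :
  sum4 (indep4 T R (fun x y => (x != y) && ~~ G x y)) + (#|T| ^_ 4)%:R
  <= 24 * (num_cliques G 4)%:R + #|T|%:R ^+ 4.
Proof.
pose P := [pred K : {set T} | clique G K & #|K| == 4].
have -> : 24 * (num_cliques G 4)%:R = sum4 (fun x y z w => \sum_(K | P K)
    (all [in K] [:: w; z; y; x] && uniq [:: w; z; y; x])%:R) :> R.
  rewrite sum4_sum /num_cliques -sum1_card natr_sum mulr_sumr.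
  rewrite (eq_bigl P) => [|K]; last by rewrite inE.
  by apply: eq_bigr => K /andP[_ /eqP K4]; rewrite sum4_distinct K4 mulr1.
rewrite -[X in X ^_ _]cardsT -sum4_distinct -[_ ^+ 4]mulr1 -sum4_const.
rewrite -!sum4D; apply: ler_sum4 => x y z w; rewrite indep4E.
set ind := [&& _, _, _, _, _ & _].
set dist := all _ _ && _.
have [/andP[ind_t dist_t]|not_both] := boolP (ind && dist); last first.
  apply: ler_wpDl; first exact: sumr_ge0.
  by rewrite -natrD lern1; move: not_both; case: ind; case: dist.
rewrite ind_t dist_t lerD2r.
pose K := [set v in [:: w; z; y; x]].
have PK : P K.
  move: dist_t => /andP[_ s_uniq]; apply/andP; split; last first.
    by rewrite cardsE (card_uniqP s_uniq).
  apply/forall_inP => u; rewrite !inE => u_in.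
  apply/forall_inP => v; rewrite !inE => v_in.
  move: ind_t; rewrite /ind !negb_and !negbK => /and5P[xy xz xw yz /andP[yw zw]].
  rewrite implybE negbK.
  by case/or4P: u_in => /eqP ->; case/or4P: v_in => /eqP ->;
    rewrite ?eqxx ?xy ?xz ?xw ?yz ?yw ?zw // eq_sym adj_sym
      ?xy ?xz ?xw ?yz ?yw ?zw.
have distK : all [in K] [:: w; z; y; x] && uniq [:: w; z; y; x].
  move: dist_t => /andP[_ ->]; rewrite andbT.
  by apply/allP => v v_in; rewrite in_set.
by rewrite (bigD1 K PK) distK lerDl sumr_ge0.
Qed.

End Counting.

(** * Lower-order terms, the complement graph and the conclusion *)

Lemma ffact4_ge (R : realFieldType) (n : nat) :
  n%:R ^+ 4 - 6 * n%:R ^+ 3 <= (n ^_ 4)%:R :> R.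
Proof.
have [n_lt|n_ge] := ltnP n 3.
  by case: n n_lt => [|[|[|//]]] _; rewrite ?ffact_small //; lra.
rewrite !ffactnSr mul1n !natrM !natrB ?(leq_trans _ n_ge) //.
have : 3 <= n%:R :> R by rewrite ler_nat.
by nra.
Qed.

Lemma compl_triangle_free (T : finType) (G : sgraph T) (x y z : T) :
  independence_number G = 2%N ->
  ~~ [&& (x != y) && ~~ G x y, (y != z) && ~~ G y z & (x != z) && ~~ G x z].
Proof.
move=> alpha2; apply/negP => /and3P[/andP[nxy Gxy] /andP[nyz Gyz] /andP[nxz Gxz]].
have := @leq_bigmax_cond _ (independent G) (fun S => #|S|) [set x; y; z].
rewrite -/(independence_number G) alpha2.
have -> : #|[set x; y; z]| = 3%N.
  by rewrite setUC cardsU1 cards2 !inE negb_or nxy eq_sym nxz eq_sym nyz.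
suff -> : independent G [set x; y; z] by move/(_ isT).
apply/forall_inP => u u_in; apply/forall_inP => v; move: u_in; rewrite !inE -!orbA.
by case/or3P => /eqP -> /or3P[] /eqP ->;
  rewrite ?adj_irr // adj_sym.
Qed.

(** Every vertex is exactly one of: a non-neighbour distinct from [x], [x] itself, a neighbour of
    [x]. *)
Lemma degree_compl (R : realFieldType) (T : finType) (G : sgraph T) (x : T) :
  \sum_y ((x != y) && ~~ G x y)%:R = #|T|%:R - 1 - (degree G x)%:R :> R.
Proof.
have -> : #|T|%:R = \sum_y (((x != y) && ~~ G x y)%:R + (x == y)%:R
    + (G x y)%:R) :> R.
  rewrite -[LHS]mulr1 -sum_const; apply: eq_bigr => y _.
  by have [->|_] := eqVneq; rewrite ?adj_irr; case: (G x y); rewrite /=; ring.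
have sum_ind (p : pred T) : \sum_y (p y)%:R = #|p|%:R :> R.
  rewrite -sum1_card natr_sum [RHS]big_mkcond; apply: eq_bigr => y _.
  by rewrite unfold_in; case: (p y).
rewrite !big_split /= (sum_ind (G x)) (sum_ind (fun y => x == y)) /degree cardsE.
rewrite (eq_card (B := pred1 x)) => [|y]; last by rewrite !inE eq_sym.
by rewrite card1; ring.
Qed.

Theorem theorem1 (R : realType) (eps : R) (heps : 0 < eps) :
  exists2 delta : R, 0 < delta &
  exists n0 : nat, forall (n m : nat) (G : sgraph 'I_n),
    (n0 <= n)%N ->
    #|edges G| = m ->
    independence_number G = 2%N ->
    \sum_(i < n) `|(degree G i)%:R - 2%:R * m%:R / n%:R| <= delta * n%:R ^+ 2 ->
    (1 / 200%:R - eps) * n%:R ^+ 4 <= (num_cliques G 4)%:R :> R.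
Proof.
(* The deviation costs 60 / 5 = 12 and the repeated tuples cost 6 multiples of [eps * n%:R ^+ 4];
   the total 18 is below the 24 available. *)
exists (eps / 5); first by rewrite divr_gt0.
exists (Num.bound eps^-1).+1 => n m G n_ge _ alpha2 dev.
pose N : R := n%:R.
have epsN : 1 <= eps * N.
  rewrite -ler_pdivrMl // mulr1 ltW //.
  apply: lt_le_trans (archi_boundP _) _; first by rewrite invr_ge0 ltW.
  by rewrite ler_nat ltnW.
have N_gt0 : 0 < N by nra.
pose H x y := (x != y) && ~~ G x y.
have H_sym : symmetric H by move=> x y; rewrite /H eq_sym adj_sym.
have H_tri x y z : ~~ [&& H x y, H y z & H x z] by exact: compl_triangle_free.
(* With this centre, complement deviations are those of [G] up to sign. *)
have := @sum4_indep4_lower _ R H H_sym H_tri (N - 1 - 2%:R * m%:R / N).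
rewrite card_ord => /(_ N_gt0).
under eq_bigr => i _.
  rewrite degree_compl card_ord (_ : _ - _ = - ((degree G i)%:R - 2%:R * m%:R / N)).
    by rewrite normrN; over.
  by rewrite /N; ring.
have := @sum4_clique_le _ R G; rewrite card_ord -/N.
have := ffact4_ge R n; rewrite -/N => ffact_ge clique_le indep_ge.
have dev_le : N ^+ 2 * \sum_(i < n) `|(degree G i)%:R - 2%:R * m%:R / N|
    <= eps / 5 * N ^+ 4.
  apply: le_trans (ler_wpM2l (sqr_ge0 N) dev) _; rewrite -/N.
  by rewrite mulrCA -exprD.
have N3_le : N ^+ 3 <= eps * N ^+ 4.
  by have := ler_wpM2r (exprn_ge0 3 (ltW N_gt0)) epsN; rewrite mul1r -mulrA -exprS.
have N3_ge0 := exprn_ge0 3 (ltW N_gt0).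
rewrite -/N; lra.
Qed.
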